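(* Let $R$ be a basic formal matrix ring of order $n$ with local rings $R_1,\dots,R_n$ on the diagonal and coordinate bimodules $B_{i,j}$, and let $\pi\in S_n$. Then $R$ is a ring with a Nakayama permutation $\pi$ if and only if for each $i\le n$ all of the following hold. (1) For every $j\le n$ with $j\neq\pi(i)$, (i) or (ii) holds (inclusive or): (i) for any nonzero $m\in B_{i,j}$ there exists an index $k\le n$, $k\neq j$, such that $mB_{j,k}\neq 0$; (ii) the right $R_j$-submodule of $B_{i,j}$ consisting of all elements $m$ such that $mB_{j,k}=0$ for all $k\neq j$ has zero socle. (1') For every $j\le n$ with $j\neq\pi(i)$, (i') or (ii') holds (inclusive or): (i') for any nonzero $m\in B_{i,j}$ there exists an index $h\le n$, $h\neq i$, such that $B_{h,i}m\neq 0$; (ii') the left $R_i$-submodule of $B_{i,j}$ consisting of all elements $m$ such that $B_{h,i}m=0$ for all $h\neq i$ has zero socle. (2) Let $N_{\pi(i)}$ be the $R_i$-$R_{\pi(i)}$-subbimodule of $B_{i,\pi(i)}$ consisting of all elements $m$ such that $mB_{\pi(i),j}=0$ for all $j\neq\pi(i)$. Its right socle $T_{\pi(i)}$ (the socle of $N_{\pi(i)}$ as a right $R_{\pi(i)}$-module) is simple as a right $R_{\pi(i)}$-module. (2') Let $N'_i$ be the $R_i$-$R_{\pi(i)}$-subbimodule of $B_{i,\pi(i)}$ consisting of all elements $m$ such that $B_{h,i}m=0$ for all $h\neq i$. Its left socle $T'_i$ (the socle of $N'_i$ as a left $R_i$-module) is simple as a left $R_i$-module.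
   Context: Rings are associative and unital; $S_n$ is the symmetric group on $\{1,\dots,n\}$; $J(R)$ is the Jacobson radical. Formal matrix ring of order $n$: given local rings $R_1,\dots,R_n$, $R_i$-$R_j$-bimodules $B_{i,j}$ (coordinate bimodules) with $B_{i,i}=R_i$, and $R_i$-$R_k$-bimodule homomorphisms (product homomorphisms) $\varphi_{i,j,k}\colon B_{i,j}\otimes_{R_j}B_{j,k}\to B_{i,k}$, written $ab:=\varphi_{i,j,k}(a\otimes b)$, where $\varphi_{i,i,j}$ and $\varphi_{i,j,j}$ are the bimodule actions and $(ab)c=a(bc)$ for all $a\in B_{i,j}$, $b\in B_{j,k}$, $c\in B_{k,l}$. The ring $R$ is the set of $n\times n$ matrices whose $(i,j)$ entry lies in $B_{i,j}$, with the usual matrix addition and multiplication. The canonical idempotent $e_i$ is the matrix with $1_{R_i}$ at position $(i,i)$ and zeros elsewhere; $e_1,\dots,e_n$ are pairwise orthogonal local idempotents with sum $1$. For $m\in B_{i,j}$, $mB_{j,k}=\{mb: b\in B_{j,k}\}$ and $B_{h,i}m=\{bm : b\in B_{h,i}\}$. $R$ is basic if the right modules $e_1R,\dots,e_nR$ are pairwise non-isomorphic. Nakayama permutation: a basic formal matrix ring $R$ of order $n$ is a ring with a Nakayama permutation $\pi\in S_n$ if for each $i\le n$ one has $soc(e_iR)\cong top(e_{\pi(i)}R)$ as right $R$-modules and $soc(Re_{\pi(i)})\cong top(Re_i)$ as left $R$-modules, where $top(M)=M/MJ(R)$ (resp. $M/J(R)M$). *)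

(* Defs.v *)
From HB Require Import structures.
From mathcomp Require Import all_boot all_order all_algebra perm.
From mathcomp Require Import boolp.

Set Implicit Arguments.
Unset Strict Implicit.
Unset Printing Implicit Defensive.

Import GRing.Theory.
Local Open Scope ring_scope.

(* Conventions.  A left A-module is an [lmodType A]; a right A-module is an
   [lmodType A^c], where A^c is the converse ring, so that [a *: m] in a right
   module stands for m a.  The ring A is the left module A^o over itself, and
   the right module (A^c)^o over itself. *)

Section Modules.
Variable A : pzRingType.

Record submodule (M : lmodType A) := Submodule {
  submod_pred :> {pred M};
  submodP : submod_closed submod_pred }.

HB.instance Definition _ (M : lmodType A) (S : submodule M) :=
  GRing.isSubmodClosed.Build A M (submod_pred S) (submodP S).

Section SubModule.
Variables (M : lmodType A) (S : submodule M).

Inductive subm : predArgType := Subm x of x \in S.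
Definition subm_val (u : subm) : M := let: Subm x _ := u in x.

HB.instance Definition _ := [isSub of subm for subm_val].
HB.instance Definition _ := [Choice of subm by <:].
HB.instance Definition _ := [SubChoice_isSubLmodule of subm by <:].
End SubModule.

Section QuotientModule.
Variables (M : lmodType A) (S : submodule M).
Local Open Scope quotient_scope.

Definition quotm := {ideal_quot S}.
HB.instance Definition _ := GRing.Zmodule.on quotm.
HB.instance Definition _ := EqQuotient.on quotm.

Definition quotm_scale (a : A) : quotm -> quotm :=
  fun x => \pi_quotm (a *: repr x).

Lemma quotm_eqP (x y : M) : reflect (\pi_quotm x = \pi_quotm y) (x - y \in S).
Proof.
rewrite (Quotient.idealrBE (submod_pred S)).
exact: eqP.
Qed.

Lemma pi_quotm_zmod (x y : M) :
  \pi_quotm x - \pi_quotm y = \pi_quotm (x - y).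
Proof. exact: esym (@pi_is_zmod_morphism M _ _ (Quotient.quot S) x y). Qed.

Lemma pi_quotmD (x y : M) : \pi_quotm x + \pi_quotm y = \pi_quotm (x + y).
Proof.
have p0 : - \pi_quotm y = \pi_quotm (- y).
  rewrite -[LHS]add0r -[X in X - _](subrr (\pi_quotm y)).
  by rewrite !pi_quotm_zmod subrr add0r.
by rewrite -[in RHS](opprK y) -pi_quotm_zmod -p0 opprK.
Qed.

Lemma quotm_scale_pi a (x : M) :
  quotm_scale a (\pi_quotm x) = \pi_quotm (a *: x).
Proof.
apply/quotm_eqP; rewrite -scalerBr; apply: rpredZ.
by apply/quotm_eqP; rewrite reprK.
Qed.

Lemma quotm_scalerA a b x :
  quotm_scale a (quotm_scale b x) = quotm_scale (a * b) x.
Proof.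
by rewrite -[x]reprK (quotm_scale_pi b (repr x)) !quotm_scale_pi scalerA.
Qed.

Lemma quotm_scale1r : left_id 1 quotm_scale.
Proof. by move=> x; rewrite -[x]reprK quotm_scale_pi scale1r. Qed.

Lemma quotm_scalerDr : right_distributive quotm_scale +%R.
Proof.
move=> a x y; rewrite -[x]reprK -[y]reprK pi_quotmD !quotm_scale_pi.
by rewrite pi_quotmD scalerDr.
Qed.

Lemma quotm_scalerDl x : {morph quotm_scale^~ x : a b / a + b}.
Proof.
by move=> a b; rewrite -[x]reprK !quotm_scale_pi pi_quotmD scalerDl.
Qed.

HB.instance Definition _ := GRing.Zmodule_isLmodule.Build A quotm
  quotm_scalerA quotm_scale1r quotm_scalerDr quotm_scalerDl.
End QuotientModule.

Definition mod_iso (M N : lmodType A) : Prop :=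
  exists f : {linear M -> N}, bijective f.

Section Generated.
Variables (M : lmodType A) (X : M -> Prop).

Definition gen_pred : {pred M} :=
  [pred x | `[< forall S : submodule M, (forall y, X y -> y \in S) -> x \in S >]].

Lemma gen_pred_closed : submod_closed gen_pred.
Proof.
split=> [|a x y /asboolP Sx /asboolP Sy]; apply/asboolP => S XS.
  exact: rpred0.
by apply: rpredD; [apply: rpredZ; apply: Sx | apply: Sy].
Qed.

Definition gen : submodule M := Submodule gen_pred_closed.
End Generated.

Definition simple_module (M : lmodType A) : Prop :=
  (exists x : M, x != 0) /\
  (forall S : submodule M,
     (forall x, x \in S -> x = 0) \/ (forall x, x \in S)).

(* The sum of the simple submodules, i.e. the submodule generated by their
   union; it is 0 if there are none. *)
Definition soc (M : lmodType A) : submodule M :=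
  gen (fun x : M => exists2 S : submodule M, simple_module (subm S) & x \in S).

Definition maximal_left_ideal (I : submodule A^o) : Prop :=
  1 \notin I /\
  (forall K : submodule A^o,
     {subset I <= K} -> 1 \notin K -> {subset K <= I}).

Definition jacobson : {pred A} :=
  [pred x | `[< forall I : submodule A^o, maximal_left_ideal I -> x \in I >]].

(* The submodule I M, generated by the products of elements of I and M. *)
Definition smul (I : {pred A}) (M : lmodType A) : submodule M :=
  gen (fun x : M => exists2 a, a \in I & exists m : M, x = a *: m).

Definition invertible (a : A) : Prop := exists b, a * b = 1 /\ b * a = 1.

(* A is nonzero and the sum of two non-units is a non-unit. *)
Definition local_ring : Prop :=
  1 != 0 :> A /\
  (forall a b : A, invertible (a + b) -> invertible a \/ invertible b).

End Modules.

Section RightLeft.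
Variable A : pzRingType.

Definition topL (M : lmodType A) := quotm (smul (@jacobson A) M).

(* J(A) is the radical of A, not of A^c: the submodule is M J(A). *)
Definition topR (M : lmodType A^c) :=
  quotm (smul (@jacobson A : {pred A^c}) M).

HB.instance Definition _ (M : lmodType A) := GRing.Lmodule.on (topL M).
HB.instance Definition _ (M : lmodType A^c) := GRing.Lmodule.on (topR M).

Section Principal.
Variable e : A.

Definition rprin_pred : {pred (A^c)^o} :=
  [pred x | `[< exists a : A, x = e * a :> A >]].
Definition lprin_pred : {pred A^o} :=
  [pred x | `[< exists a : A, x = a * e :> A >]].

Lemma rprin_pred_closed : submod_closed rprin_pred.
Proof.
split=> [|a x y /asboolP[b ->] /asboolP[c ->]]; apply/asboolP.
  by exists 0; rewrite mulr0.
by exists (b * a + c); rewrite mulrDr mulrA.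
Qed.

Lemma lprin_pred_closed : submod_closed lprin_pred.
Proof.
split=> [|a x y /asboolP[b ->] /asboolP[c ->]]; apply/asboolP.
  by exists 0; rewrite mul0r.
by exists (a * b + c); rewrite mulrDl -mulrA.
Qed.

(* eA as a right A-module, Ae as a left A-module. *)
Definition rprin := subm (Submodule rprin_pred_closed).
Definition lprin := subm (Submodule lprin_pred_closed).
HB.instance Definition _ := GRing.Lmodule.on rprin.
HB.instance Definition _ := GRing.Lmodule.on lprin.
End Principal.

End RightLeft.

(* The data defining a formal matrix ring.  [bimod i j] is B_{i,j} and
   [prodh i j k] is the biadditive map (a, b) |-> ab = phi_{i,j,k}(a (x) b);
   the rings R_i are recovered as B_{i,i}, with multiplication phi_{i,i,i}, and
   the bimodule structure of B_{i,j} is given by phi_{i,i,j} and phi_{i,j,j}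
   (the instances on [diag], [bimodL] and [bimodR] below).  The ring axioms of
   R_i, the bimodule axioms, and the facts that the product maps are
   R_j-balanced, left R_i-linear and right R_k-linear are all cases of [prodhA],
   the unit laws and biadditivity. *)
Record fm_data (n : nat) := FMData {
  bimod : 'I_n -> 'I_n -> zmodType;
  prodh : forall i j k, bimod i j -> bimod j k -> bimod i k;
  diag1 : forall i, bimod i i;
  prodhDl : forall i j k (a a' : bimod i j) (b : bimod j k),
    prodh (a + a') b = prodh a b + prodh a' b;
  prodhDr : forall i j k (a : bimod i j) (b b' : bimod j k),
    prodh a (b + b') = prodh a b + prodh a b';
  prodhA : forall i j k l (a : bimod i j) (b : bimod j k) (c : bimod k l),
    prodh (prodh a b) c = prodh a (prodh b c);
  prod1h : forall i j (a : bimod i j), prodh (diag1 i) a = a;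
  prodh1 : forall i j (a : bimod i j), prodh a (diag1 j) = a }.

Section FormalMatrix.
Variables (n : nat) (D : fm_data n).
Implicit Types i j k : 'I_n.

Definition diag i : Type := bimod D i i.
HB.instance Definition _ i := GRing.Zmodule.on (diag i).
HB.instance Definition _ i := @GRing.Zmodule_isPzRing.Build (diag i)
  (diag1 D i) (@prodh n D i i i)
  (fun a b c => esym (prodhA a b c)) (@prod1h n D i i) (@prodh1 n D i i)
  (fun a b c => prodhDl a b c) (fun a b c => prodhDr a b c).

(* B_{i,j} as a left R_i-module and as a right R_j-module. *)
Definition bimodL i j : Type := bimod D i j.
HB.instance Definition _ i j := GRing.Zmodule.on (bimodL i j).
HB.instance Definition _ i j :=
  @GRing.Zmodule_isLmodule.Build (diag i) (bimodL i j)
  (fun a m => @prodh n D i i j a m)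
  (fun a b m => esym (prodhA a b m)) (@prod1h n D i j)
  (fun a => @prodhDr n D i i j a) (fun m a b => @prodhDl n D i i j a b m).

Definition bimodR i j : Type := bimod D i j.
HB.instance Definition _ i j := GRing.Zmodule.on (bimodR i j).
HB.instance Definition _ i j :=
  @GRing.Zmodule_isLmodule.Build (diag j)^c (bimodR i j)
  (fun a m => @prodh n D i j j m a)
  (fun a b m => prodhA m b a) (@prodh1 n D i j)
  (fun a m m' => @prodhDl n D i j j m m' a) (fun m => @prodhDr n D i j j m).

Lemma prod0h i j k (b : bimod D j k) : prodh (0 : bimod D i j) b = 0.
Proof. by apply: (addIr (prodh 0 b)); rewrite -prodhDl !add0r. Qed.

Lemma prodh0 i j k (a : bimod D i j) : prodh a (0 : bimod D j k) = 0.
Proof. by apply: (addIr (prodh a 0)); rewrite -prodhDr !add0r. Qed.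

Lemma prodh_suml i j k (F : 'I_n -> bimod D i j) (b : bimod D j k) :
  prodh (\sum_l F l) b = \sum_l prodh (F l) b.
Proof.
by apply: (big_morph (fun x => prodh x b)) => [x y|]; rewrite (prodhDl, prod0h).
Qed.

Lemma prodh_sumr i j k (a : bimod D i j) (F : 'I_n -> bimod D j k) :
  prodh a (\sum_l F l) = \sum_l prodh a (F l).
Proof.
by apply: (big_morph (prodh a)) => [x y|]; rewrite (prodhDr, prodh0).
Qed.

Definition fmx := {dffun forall p : 'I_n * 'I_n, bimod D p.1 p.2}.
HB.instance Definition _ := Choice.on fmx.

Definition entry (A : fmx) i j : bimod D i j := A (i, j).

Definition fmx_of (F : forall i j, bimod D i j) : fmx :=
  [ffun p : 'I_n * 'I_n => F p.1 p.2].

Lemma fmx_ofE F i j : entry (fmx_of F) i j = F i j.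
Proof. by rewrite /entry ffunE. Qed.

Lemma fmxP (A B : fmx) : (forall i j, entry A i j = entry B i j) -> A = B.
Proof. by move=> AB; apply/ffunP => -[i j]; apply: AB. Qed.

Definition fmx_add (A B : fmx) := fmx_of (fun i j => entry A i j + entry B i j).
Definition fmx_opp (A : fmx) := fmx_of (fun i j => - entry A i j).
Definition fmx_zero := fmx_of (fun i j => 0).

Lemma fmx_addA : associative fmx_add.
Proof. by move=> A B C; apply: fmxP => i j; rewrite !fmx_ofE addrA. Qed.
Lemma fmx_addC : commutative fmx_add.
Proof. by move=> A B; apply: fmxP => i j; rewrite !fmx_ofE addrC. Qed.
Lemma fmx_add0 : left_id fmx_zero fmx_add.
Proof. by move=> A; apply: fmxP => i j; rewrite !fmx_ofE add0r. Qed.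
Lemma fmx_addN : left_inverse fmx_zero fmx_opp fmx_add.
Proof. by move=> A; apply: fmxP => i j; rewrite !fmx_ofE addNr. Qed.

HB.instance Definition _ :=
  GRing.isZmodule.Build fmx fmx_addA fmx_addC fmx_add0 fmx_addN.

Lemma fmx_addE (A B : fmx) i j : entry (A + B) i j = entry A i j + entry B i j.
Proof. exact: fmx_ofE. Qed.

Definition fmx_mul (A B : fmx) :=
  fmx_of (fun i j => \sum_k prodh (entry A i k) (entry B k j)).

(* 1_{R_i} if i = j, and 0 otherwise. *)
Definition id_entry i j : bimod D i j :=
  match i =P j with
  | ReflectT eq_ij => eq_rect i (bimod D i) (diag1 D i) j eq_ij
  | ReflectF _ => 0
  end.

Lemma id_entry_id i : id_entry i i = diag1 D i.
Proof. by rewrite /id_entry; case: eqP => // e; rewrite eq_axiomK. Qed.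

Lemma id_entry_neq i j : i != j -> id_entry i j = 0.
Proof. by rewrite /id_entry; case: eqP. Qed.

Definition fmx_one := fmx_of id_entry.

Lemma fmx_mulA : associative fmx_mul.
Proof.
move=> A B C; apply: fmxP => i j; rewrite !fmx_ofE.
under eq_bigr => k _ do rewrite fmx_ofE prodh_sumr.
rewrite exchange_big /=; apply: eq_bigr => l _.
by rewrite fmx_ofE prodh_suml; apply: eq_bigr => k _; rewrite prodhA.
Qed.

Lemma fmx_mul1 : left_id fmx_one fmx_mul.
Proof.
move=> A; apply: fmxP => i j; rewrite fmx_ofE (bigD1 i) //= fmx_ofE id_entry_id.
rewrite prod1h big1 ?addr0 // => k k_i.
by rewrite fmx_ofE id_entry_neq 1?eq_sym // prod0h.
Qed.

Lemma fmx_1mul : right_id fmx_one fmx_mul.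
Proof.
move=> A; apply: fmxP => i j; rewrite fmx_ofE (bigD1 j) //= fmx_ofE id_entry_id.
rewrite prodh1 big1 ?addr0 // => k k_j.
by rewrite fmx_ofE id_entry_neq // prodh0.
Qed.

Lemma fmx_mulDl : left_distributive fmx_mul +%R.
Proof.
move=> A B C; apply: fmxP => i j; rewrite fmx_addE !fmx_ofE -big_split /=.
by apply: eq_bigr => k _; rewrite fmx_addE prodhDl.
Qed.

Lemma fmx_mulDr : right_distributive fmx_mul +%R.
Proof.
move=> A B C; apply: fmxP => i j; rewrite fmx_addE !fmx_ofE -big_split /=.
by apply: eq_bigr => k _; rewrite fmx_addE prodhDr.
Qed.

HB.instance Definition _ := GRing.Zmodule_isPzRing.Build fmx
  fmx_mulA fmx_mul1 fmx_1mul fmx_mulDl fmx_mulDr.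

(* The canonical idempotent e_i. *)
Definition cidem i : fmx :=
  fmx_of (fun k l => if k == i then id_entry k l else 0).

Definition basic : Prop :=
  forall i j, i != j -> ~ mod_iso (rprin (cidem i)) (rprin (cidem j)).

Definition nakayama_perm (s : 'S_n) : Prop :=
  forall i,
    mod_iso (subm (soc (rprin (cidem i)))) (topR (rprin (cidem (s i)))) /\
    mod_iso (subm (soc (lprin (cidem (s i))))) (topL (lprin (cidem i))).

Section Annihilated.
Variables i j : 'I_n.

(* Elements m of B_{i,j} with m B_{j,k} = 0 for all k <> j. *)
Definition annR_pred : {pred bimodR i j} :=
  [pred m | `[< forall k, k != j ->
                forall b : bimod D j k, prodh (m : bimod D i j) b = 0 >]].

(* Elements m of B_{i,j} with B_{h,i} m = 0 for all h <> i. *)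
Definition annL_pred : {pred bimodL i j} :=
  [pred m | `[< forall h, h != i ->
                forall b : bimod D h i, prodh b (m : bimod D i j) = 0 >]].

Lemma annR_closed : submod_closed annR_pred.
Proof.
split=> [|a x y /asboolP x0 /asboolP y0]; apply/asboolP => k kj b.
  exact: prod0h.
by rewrite prodhDl prodhA x0 // y0 // addr0.
Qed.

Lemma annL_closed : submod_closed annL_pred.
Proof.
split=> [|a x y /asboolP x0 /asboolP y0]; apply/asboolP => h hi b.
  exact: prodh0.
by rewrite prodhDr -prodhA x0 // y0 // addr0.
Qed.

Definition annR : submodule (bimodR i j) := Submodule annR_closed.
Definition annL : submodule (bimodL i j) := Submodule annL_closed.
End Annihilated.

End FormalMatrix.

(* Main.v *)
Require Import Defs.
From HB Require Import structures.
From mathcomp Require Import all_boot all_order all_algebra perm.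
From mathcomp Require Import boolp.

(** Write R for the ring of matrices and e_i for its canonical idempotents.

    The heart of the matter is that a simple module over a basic semiperfect
    ring lives on one idempotent.  If S is simple and e_k S and e_l S are both
    nonzero with k <> l, then nonzero elements x of e_k S and y of e_l S are
    multiples of each other, x = b a x with b a in e_k R e_l R e_k.  By
    locality of e_k R e_k the element b a is a unit there, and locality of
    e_l R e_l then makes a and b invertible, so that e_k R and e_l R are
    isomorphic, against basicness ([corner_unit_mul_orth],
    [simple_component]).  In the same way every matrix whose diagonal entries
    are all non-units kills all simple modules ([simple_rad]), and these
    matrices form J(R) ([jacobson_frame]).  Consequently top(e_j R) is simple,
    and a module is isomorphic to it if and only if it is simple and not
    killed by e_j ([simple_iso_top], [iso_top_simple]).

    Apply this to soc(e_i R).  A simple submodule S of e_i R living on e_j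
    consists of elements of B_{i,j} killed by every B_{j,k} with k <> j, hence
    lies in the annihilator [annR D i j]; and on that annihilator a matrix acts
    through its (j,j) entry alone, so that R-submodules and R_j-submodules are
    the same.  Thus soc(e_i R) is the direct sum over j of the socles of the
    R_j-modules [annR D i j] ([soc_corner_img], [soc_component]), and it is
    isomorphic to top(e_j R) exactly when the socle of [annR D i l] is 0 for
    all l <> j and that of [annR D i j] is simple ([socR_iso_top]).  The left
    modules R e_j behave likewise ([socL_iso_top]).

    With j = s i this is the theorem: the first alternative of the
    vanishing condition says that the annihilator itself is 0, so both
    alternatives give zero socle.  On the left, the socle of column s i
    involves all rows l <> i, i.e. the pairs (l, s i) with s l <> s i; letting
    i vary, these are all pairs (l, j) with j <> s l.

    Both sides are obtained from a single argument about left modules over a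
    ring with a suitable family of idempotents ([basic_frame]), a notion that
    is invariant under passing to the converse ring. *)

Set Implicit Arguments.
Unset Strict Implicit.
Unset Printing Implicit Defensive.

Import GRing.Theory.
Local Open Scope ring_scope.

(** * Submodules, simple submodules and socles *)

Section Submodules.
Variables (A : pzRingType) (M : lmodType A).

Definition submodule_pred (P : M -> Prop) : Prop :=
  P 0 /\ forall a x y, P x -> P y -> P (a *: x + y).

Lemma submodule_pred_closed (P : M -> Prop) :
  submodule_pred P -> submod_closed [pred x | `[< P x >]].
Proof.
move=> [P0 PD]; split=> [|a x y /asboolP Px /asboolP Py]; apply/asboolP => //.
exact: PD.
Qed.

Definition sub_of (P : M -> Prop) (PP : submodule_pred P) : submodule M :=
  Submodule (submodule_pred_closed PP).

Lemma sub_ofP (P : M -> Prop) (PP : submodule_pred P) x :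
  reflect (P x) (x \in sub_of PP).
Proof. exact: asboolP. Qed.

End Submodules.

Section SimpleSubmodules.
Variables (A : pzRingType) (M : lmodType A).

(** Simplicity of a submodule in terms of the submodules of the ambient module,
    which avoids submodules of submodules when socles are compared. *)
Definition simple_sub (S : submodule M) : Prop :=
  (exists2 x, x \in S & x != 0) /\
  forall T : submodule M, {subset T <= S} ->
    (forall x, x \in T -> x = 0) \/ {subset S <= T}.

Lemma simple_subE (S : submodule M) : simple_module (subm S) <-> simple_sub S.
Proof.
split=> [[[x x0] Smin] | [[x Sx x0] Smin]]; split.
- exists (val x); first exact: valP.
  by apply: contra x0 => /eqP x0; apply/eqP/val_inj.
- move=> T TS; have TP : submodule_pred (fun u : subm S => val u \in T).
    split=> [|a u v Tu Tv]; first by rewrite GRing.val0 rpred0.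
    by rewrite GRing.valD GRing.valZ rpredD ?rpredZ.
  case: (Smin (sub_of TP)) => T_; [left | right] => y yT.
    have /sub_ofP/T_ : val (Subm (TS y yT)) \in T by [].
    by move/(congr1 val).
  by have /sub_ofP := T_ (Subm yT).
- by exists (Subm Sx); apply: contra x0 => /eqP/(congr1 val)/= ->.
- move=> T; have TP : submodule_pred (fun y => exists2 u, u \in T & val u = y).
    split=> [|a y z [u Tu <-] [v Tv <-]]; first by exists 0; rewrite ?rpred0.
    by exists (a *: u + v); rewrite ?rpredD ?rpredZ.
  case: (Smin (sub_of TP)) => [y /sub_ofP[u Tu <-] | T_ | T_].
  + exact: valP.
  + by left=> u Tu; apply/val_inj/T_/sub_ofP; exists u.
  + right=> u; have /sub_ofP[v Tv /val_inj <- //] := T_ _ (valP u).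
Qed.

Lemma fullsub_closed : @submodule_pred A M (fun _ => True).
Proof. by []. Qed.
Definition fullsub := sub_of fullsub_closed.

Lemma simple_fullsub : simple_module M -> simple_sub fullsub.
Proof.
move=> [[x x0] Mmin]; split; first by exists x => //; apply/sub_ofP.
by move=> T _; case: (Mmin T) => T_; [left | right=> y _; apply: T_].
Qed.

Lemma cyclic_closed x : submodule_pred (fun y : M => exists a : A, y = a *: x).
Proof.
split=> [|a _ _ [b ->] [c ->]]; first by exists 0; rewrite scale0r.
by exists (a * b + c); rewrite scalerDl scalerA.
Qed.

Lemma simple_cyclic (S : submodule M) x y :
  simple_sub S -> x \in S -> x != 0 -> y \in S -> exists a, y = a *: x.
Proof.
move=> [_ Smin] Sx x0 Sy.
case: (Smin (sub_of (cyclic_closed x))) => [z /sub_ofP[a ->]|Ax0|Ax].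
- exact: rpredZ.
- case/eqP: x0; by apply/Ax0/sub_ofP; exists 1; rewrite scale1r.
- by have /sub_ofP := Ax _ Sy.
Qed.

Lemma mem_soc (S : submodule M) x : simple_sub S -> x \in S -> x \in soc M.
Proof.
by move=> Ss Sx; apply/asboolP => T; apply; exists S => //; apply/simple_subE.
Qed.

Lemma soc_sub (T : submodule M) :
  (forall S, simple_sub S -> {subset S <= T}) -> {subset soc M <= T}.
Proof.
move=> sST x /asboolP; apply=> y [S /simple_subE Ss Sy].
exact: (sST S).
Qed.

End SimpleSubmodules.

(** * Isomorphisms of modules *)

Section Isomorphisms.
Variable A : pzRingType.
Implicit Types M N : lmodType A.

(** Schur's lemma. *)
Lemma simple_linear_bij M N (f : M -> N) :
  linear f -> simple_module M -> simple_module N -> (exists x, f x != 0) ->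
  bijective f.
Proof.
move=> fL [_ Mmin] [_ Nmin] [x fx0].
pose F : {linear M -> N} := HB.pack f (GRing.isLinear.Build A M N *:%R f fL).
have kerP : submodule_pred (fun y => F y = 0).
  split=> [|a y z Fy Fz]; first exact: linear0.
  by rewrite linearP Fy Fz scaler0 addr0.
have imP : submodule_pred (fun z => exists y, F y = z).
  split=> [|a _ _ [y <-] [z <-]]; first by exists 0; rewrite linear0.
  by exists (a *: y + z); rewrite linearP.
have f_inj : injective F.
  case: (Mmin (sub_of kerP)) => [ker0|/(_ x)/sub_ofP fx]; last first.
    by case/eqP: fx0.
  move=> y z Fyz; apply/eqP; rewrite -subr_eq0; apply/eqP/ker0/sub_ofP.
  by rewrite linearB Fyz subrr.
case: (Nmin (sub_of imP)) => [im0|imT].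
  by case/eqP: fx0; apply/im0/sub_ofP; exists x.
have {}imT z : exists y, F y == z by have /sub_ofP[y <-] := imT z; exists y.
exists (fun z => xchoose (imT z)) => [y | z]; last exact/eqP/(xchooseP (imT z)).
exact/f_inj/eqP/(xchooseP (imT (f y))).
Qed.

Lemma bij_linear_iso M N (f : M -> N) : linear f -> bijective f -> mod_iso M N.
Proof.
move=> fL fB.
by exists (HB.pack f (GRing.isLinear.Build A M N *:%R f fL) : {linear M -> N}).
Qed.

Lemma mod_iso_sym M N : mod_iso M N -> mod_iso N M.
Proof.
move=> [f [g fK gK]]; apply: (@bij_linear_iso _ _ g); last by exists f.
by move=> a x y; rewrite -{1}[x]gK -{1}[y]gK -linearP fK.
Qed.

Lemma simple_iso M N : mod_iso M N -> simple_module N -> simple_module M.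
Proof.
move=> [f [g fK gK]] [[y y0] Nmin]; split.
  exists (g y); apply: contra y0 => /eqP gy0.
  by rewrite -[y]gK gy0 linear0.
move=> S; have SP : submodule_pred (fun z => exists2 x, x \in S & f x = z).
  split=> [|a _ _ [u Su <-] [v Sv <-]].
    by exists 0; rewrite ?rpred0 ?linear0.
  by exists (a *: u + v); rewrite ?rpredD ?rpredZ ?linearP.
case: (Nmin (sub_of SP)) => S_; [left=> x Sx | right=> x].
  by apply: (can_inj fK); rewrite linear0; apply/S_/sub_ofP; exists x.
by have /sub_ofP[z Sz /(can_inj fK) <-] := S_ (f x).
Qed.

End Isomorphisms.

(** * Rings with a basic family of local idempotents *)

Section Frame.
Variables (n : nat) (A : pzRingType) (e : 'I_n -> A).

(** Invertibility of e_i a e_i in the corner ring e_i A e_i.  Stated for an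
    arbitrary a, it needs no type for the corner ring. *)
Definition corner_unit i a : Prop :=
  exists b, e i * b * e i * a * e i = e i /\ e i * a * e i * b * e i = e i.

(** A complete orthogonal family of local idempotents whose projective modules
    are pairwise non-isomorphic: the last field excludes a pair of mutually
    inverse elements of e_j A e_i and e_i A e_j.  All the fields are left-right
    symmetric, see [basic_frame_converse]. *)
Record basic_frame : Prop := BasicFrame {
  frame_idem : forall i, e i * e i = e i;
  frame_orth : forall i j, i != j -> e i * e j = 0;
  frame_sum : \sum_i e i = 1;
  frame_neq0 : forall i, e i != 0;
  frame_local : forall i a b,
    corner_unit i (a + b) -> corner_unit i a \/ corner_unit i b;
  frame_basic : forall i j a b, i != j -> e i * b * e j * a * e i = e i ->
    e j * a * e i * b * e j = e j -> False }.

(** The elements of the Jacobson radical, by [jacobson_frame]. *)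
Definition frame_rad a : Prop := forall i, ~ corner_unit i a.

Hypothesis frameA : basic_frame.
Let ee := frame_idem frameA.

Lemma corner_unit_idem i : corner_unit i (e i).
Proof. by exists (e i); rewrite !ee. Qed.

Lemma corner_unit0 i : ~ corner_unit i 0.
Proof.
case=> b [/esym]; rewrite mulr0 mul0r => e0.
by case/eqP: (frame_neq0 frameA i).
Qed.

Lemma cornerM i j k a b :
  (e i * a * e j) * (e j * b * e k) = e i * a * e j * b * e k.
Proof. by rewrite !mulrA -(mulrA (e i * a)) ee. Qed.

(** In a local ring one-sided inverses are two-sided: if y x = 1, then x y is an
    idempotent, and so is 1 - x y; one of them is a unit.  If x y is, then y
    also is a right inverse of x; if 1 - x y is, then x = 0 because
    (1 - x y) x = 0. *)
Lemma left_corner_unit i a b : e i * b * e i * a * e i = e i -> corner_unit i a.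
Proof.
rewrite -cornerM => ba; set x := e i * a * e i in ba; set y := e i * b * e i in ba.
have xe : x * e i = x by rewrite /x -!mulrA ee.
have ye : y * e i = y by rewrite /y -!mulrA ee.
have ex : e i * x = x by rewrite /x !mulrA ee.
have ey : e i * y = y by rewrite /y !mulrA ee.
pose c := a * e i * b.
have cE : e i * c * e i = x * y by rewrite /x /y cornerM /c !mulrA.
have : corner_unit i (c + (e i - c)).
  by rewrite addrC subrK; apply: corner_unit_idem.
case/(frame_local frameA) => -[d]; rewrite -!cornerM.
  rewrite cE => -[_ xyz].
  exists b; rewrite -!cornerM -/x -/y; split=> //; move: (e i * d * e i) xyz => z.
  clearbody x y => xyz; suff -> : y = y * z by rewrite mulrA.
  by rewrite -{1}ye -xyz !mulrA ba ey.
rewrite mulrBr mulrBl !ee cE; move: (e i * d * e i) => z [zxy _].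
clearbody x y; have x0 : x = 0.
  by rewrite -ex -zxy -(mulrA z) mulrBl ex -(mulrA x) ba xe subrr mulr0.
by case/eqP: (frame_neq0 frameA i); rewrite -ba x0 mulr0.
Qed.

Lemma corner_unitD k a b :
  ~ corner_unit k a -> ~ corner_unit k b -> ~ corner_unit k (a + b).
Proof. by move=> na nb /(frame_local frameA) []. Qed.

Lemma corner_unit_sum k (F : 'I_n -> A) :
  (forall i, ~ corner_unit k (F i)) -> ~ corner_unit k (\sum_i F i).
Proof.
move=> nF; apply: (big_ind (fun x => ~ corner_unit k x)) => // [|x y].
  exact: corner_unit0.
exact: corner_unitD.
Qed.

(** Were e_k a e_i b e_k a unit, it would yield p in e_i A e_k and q in
    e_k A e_i with q p = e_k.  Then p q is an idempotent of the local ring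
    e_i A e_i, so it is e_i, which contradicts basicness, or 0, which gives
    e_k = q p q p = 0. *)
Lemma corner_unit_mul_orth i k a b : i != k -> ~ corner_unit k (a * e i * b).
Proof.
move=> ik [c [l r]].
pose p := e i * b * e k; pose q := e k * (c * e k * a) * e i.
have qp : q * p = e k.
  by rewrite -[RHS]l /q /p !mulrA -(mulrA (_ * a)) ee.
have ep : e i * p = p by rewrite /p !mulrA ee.
have pe : p * e k = p by rewrite /p -!mulrA ee.
have qe : q * e i = q by rewrite /q -!mulrA ee.
have pqpq : (p * q) * (p * q) = p * q.
  by rewrite mulrA -(mulrA p) qp pe.
have pqE : e i * (p * q) * e i = p * q by rewrite mulrA ep -mulrA qe.
have pq_neq : p * q <> e i.
  move=> pq; apply: (@frame_basic frameA k i b (c * e k * a)).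
  - by rewrite eq_sym.
  - by rewrite -cornerM -/p -/q.
  - by rewrite -cornerM -/p -/q.
clearbody p q; have : corner_unit i (p * q + (e i - p * q)).
  by rewrite addrC subrK; apply: corner_unit_idem.
case/(frame_local frameA) => -[d [dl _]]; move: dl; rewrite -cornerM.
  rewrite pqE; move: (e i * d * e i) => z zpq; apply: pq_neq.
  by rewrite -{1}ep -{1}zpq -!(mulrA z) -(mulrA (p * q)) pqpq zpq.
rewrite mulrBr mulrBl pqE !ee; move: (e i * d * e i) => z zpq.
have pq0 : p * q = 0.
  by rewrite -ep -zpq -!(mulrA z) mulrBl -(mulrA p q p) qp pe ep subrr mul0r mulr0.
move/eqP: (frame_neq0 frameA k); apply.
by rewrite -(ee k) -qp -mulrA (mulrA p) pq0 mul0r mulr0.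
Qed.

Lemma rad_mull a c : frame_rad a -> frame_rad (c * a).
Proof.
move=> ra k; have -> : c * a = \sum_i c * e i * a.
  by rewrite -mulr_suml -mulr_sumr (frame_sum frameA) mulr1.
apply: corner_unit_sum => i; case: (eqVneq i k) => [-> | ik]; last first.
  exact: corner_unit_mul_orth.
case=> b [l _]; apply: (ra k); apply: (@left_corner_unit _ _ (b * e k * c)).
by rewrite -[RHS]l !mulrA.
Qed.

Lemma radD a b : frame_rad a -> frame_rad b -> frame_rad (a + b).
Proof. by move=> ra rb k; apply: corner_unitD. Qed.

Lemma corner_unit_mule k a : corner_unit k (a * e k) <-> corner_unit k a.
Proof.
have eA x : e k * (e k * x) = e k * x by rewrite mulrA ee.
by split=> -[b [l r]]; exists b; move: l r; rewrite -!mulrA ?(eA, ee).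
Qed.

Lemma rad_mule k a : ~ corner_unit k a -> frame_rad (a * e k).
Proof.
move=> na i; case: (eqVneq i k) => [-> /corner_unit_mule // | ik].
have ki : k != i by rewrite eq_sym.
case=> b [/esym/eqP + _]; apply/negP.
by rewrite -!mulrA (frame_orth frameA ki) !mulr0; apply: (frame_neq0 frameA).
Qed.

Lemma corner_unit1 k : corner_unit k 1.
Proof. by exists 1; rewrite !mulr1 !ee. Qed.

Lemma frame_decomp (M : lmodType A) (x : M) : x = \sum_i e i *: x.
Proof. by rewrite -scaler_suml (frame_sum frameA) scale1r. Qed.

Lemma frame_comp (M : lmodType A) k (x : M) :
  (forall l, l != k -> e l *: x = 0) -> x = e k *: x.
Proof. by move=> x0; rewrite {1}[x]frame_decomp (bigD1 k) //= big1 ?addr0. Qed.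

(** Otherwise e_k - e_k u e_k would be a unit of the local corner ring, but it
    kills x. *)
Lemma corner_unit_fix (M : lmodType A) k (x : M) u :
  x != 0 -> e k *: x = x -> (e k * u) *: x = x -> corner_unit k u.
Proof.
move=> x0 ex ux; have : corner_unit k (u + (e k - u)).
  by rewrite addrC subrK; apply: corner_unit_idem.
case/(frame_local frameA) => // -[d [dl _]]; case/eqP: x0.
rewrite -ex -dl -!scalerA ex scalerBl ex scalerBr ex (scalerA (e k) u) ux subrr.
by rewrite !scaler0.
Qed.

(** Nonzero components of x and y in e_k S and e_l S are multiples of each
    other, so an element of e_k A e_l A e_k fixes e_k x and is a unit by
    [corner_unit_fix], contradicting [corner_unit_mul_orth]. *)
Lemma simple_component (M : lmodType A) (S : submodule M) k l x y :
  simple_sub S -> x \in S -> y \in S -> e k *: x != 0 -> l != k -> e l *: y = 0.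
Proof.
move=> Ss Sx Sy x0 lk; apply/eqP/negPn/negP => y0.
have [a ya] := simple_cyclic Ss (rpredZ (e k) Sx) x0 (rpredZ (e l) Sy).
have [b xb] := simple_cyclic Ss (rpredZ (e l) Sy) y0 (rpredZ (e k) Sx).
apply: (@corner_unit_mul_orth l k b a) => //.
apply: (corner_unit_fix x0); first by rewrite scalerA ee.
by rewrite -!scalerA -ya (scalerA (e l) (e l)) ee -xb scalerA ee.
Qed.

(** If a x were nonzero, say with nonzero component at i, then all of S would be
    concentrated at i and x would be a multiple b e_i a x of that component.
    Then e_i b e_i a e_i is a unit, hence so is e_i a e_i. *)
Lemma simple_rad (M : lmodType A) (S : submodule M) a x :
  simple_sub S -> x \in S -> frame_rad a -> a *: x = 0.
Proof.
move=> Ss Sx ra; apply/eqP/negPn/negP => ax0.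
have [i iax0] : exists i, e i *: (a *: x) != 0.
  apply/not_existsP => ax_; case/eqP: ax0; rewrite [a *: x]frame_decomp big1 //.
  by move=> i _; apply/eqP/negPn/negP/ax_.
have xE : x = e i *: x.
  apply: frame_comp => l; exact: (simple_component Ss (rpredZ a Sx) Sx iax0).
have x0 : x != 0 by apply: contraNneq ax0 => ->; rewrite scaler0.
have [b xb] := simple_cyclic Ss (rpredZ (e i) (rpredZ a Sx)) iax0 Sx.
have [d [l _]] : corner_unit i (b * e i * a).
  by apply: (corner_unit_fix x0) => //; rewrite -!scalerA -xb.
apply: (ra i); apply: (@left_corner_unit i a (d * e i * b)).
by rewrite -[RHS]l !mulrA.
Qed.

End Frame.

(** * Passing to the converse ring *)

Section Converse.
Variables (n : nat) (A : pzRingType) (e : 'I_n -> A).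

Lemma corner_unit_converse i (a : A) :
  @corner_unit n A^c e i a <-> corner_unit e i a.
Proof.
split=> -[b [l r]]; exists b; split.
- by rewrite -!mulrA; apply: r.
- by rewrite -!mulrA; apply: l.
- by rewrite -!mulrA; apply: r.
- by rewrite -!mulrA; apply: l.
Qed.

Lemma basic_frame_converse : basic_frame e -> @basic_frame n A^c e.
Proof.
move=> [ee eo e1 e0 eL eB]; split=> //.
- by move=> i j ij; apply: eo; rewrite eq_sym.
- by move=> i a b /corner_unit_converse/eL[] /corner_unit_converse; auto.
- move=> i j a b ij l r; apply: (eB i j b a ij).
    by rewrite -!mulrA; apply: l.
  by rewrite -!mulrA; apply: r.
Qed.

Lemma frame_rad_converse (a : A) : @frame_rad n A^c e a <-> frame_rad e a.
Proof. by split=> ra i /corner_unit_converse /ra. Qed.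

Lemma rad_mulr a c : basic_frame e -> frame_rad e a -> frame_rad e (a * c).
Proof.
move=> /basic_frame_converse frameA /frame_rad_converse ra.
by apply/frame_rad_converse; apply: (@rad_mull _ A^c).
Qed.

End Converse.

(** * Simplicity of the tops of the indecomposable projectives *)

Section Top.
Variables (n : nat) (A : pzRingType) (e : 'I_n -> A).
Hypothesis frameA : basic_frame e.
(* P is a copy of A e_k with g in place of e_k.  Keeping it abstract lets the
   same results apply to A e_k and, over the converse ring, to e_k A; likewise J
   is the Jacobson radical of A or of its converse. *)
Variables (P : lmodType A) (k : 'I_n) (g : P) (J : {pred A}).
Hypothesis eg : e k *: g = g.
Hypothesis genP : forall x, exists a, x = a *: g.
Hypothesis annP : forall a, a *: g = 0 -> a * e k = 0.
Hypothesis radJ : forall a, a \in J <-> frame_rad e a.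

Local Notation rad := (smul J P).
Local Notation top := (quotm rad).
Local Notation "\pi x" := (\pi_top%qT x) (at level 10).

Let piP x y : reflect (\pi x = \pi y) (x - y \in rad) := quotm_eqP rad x y.

Let piZ a x : a *: \pi x = \pi (a *: x) := quotm_scale_pi rad a x.

Let pi0 : \pi 0 = 0.
Proof. by rewrite -[X in \pi X](scale0r 0) -piZ scale0r. Qed.

Lemma mem_rad_cyclic a : a *: g \in rad <-> ~ corner_unit e k a.
Proof.
split=> [ag | na]; last first.
  apply/asboolP => S SJ; rewrite -eg scalerA; apply: SJ.
  exists (a * e k); last by exists g.
  exact/radJ/rad_mule.
have TP : submodule_pred (fun x : P =>
    exists2 c, x = c *: g & frame_rad e (c * e k)).
  split=> [|d _ _ [b -> rb] [c -> rc]].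
    by exists 0; rewrite ?scale0r ?mul0r // => i; apply: corner_unit0.
  exists (d * b + c); first by rewrite scalerDl scalerA.
  by rewrite mulrDl -mulrA; apply: radD => //; apply: rad_mull.
have /sub_ofP[c agc rc] : a *: g \in sub_of TP.
  move/asboolP: ag; apply=> _ [b /radJ rb [m ->]]; apply/sub_ofP.
  have [d ->] := genP m; exists (b * d); first by rewrite scalerA.
  by apply: rad_mulr => //; apply: rad_mulr.
move/(corner_unit_mule frameA); suff -> : a * e k = c * e k by apply: rc.
apply/eqP; rewrite -subr_eq0 -mulrBl; apply/eqP/annP.
by rewrite scalerBl agc subrr.
Qed.

Lemma top_gen (q : top) : exists a, q = \pi (a *: g).
Proof. by have [a ga] := genP (repr q); exists a; rewrite -ga reprK. Qed.

Lemma pi_eq0 a : \pi (a *: g) = 0 <-> ~ corner_unit e k a.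
Proof.
rewrite -pi0 -mem_rad_cyclic -[X in X \in _]subr0.
by split=> /piP.
Qed.

Lemma top_gen_neq0 : \pi g != 0.
Proof.
apply/eqP; rewrite -[g]scale1r pi_eq0; apply; exact: corner_unit1.
Qed.

Lemma top_gen_fix : e k *: \pi g = \pi g.
Proof. by rewrite piZ eg. Qed.

Lemma top_simple : simple_module top.
Proof.
split=> [|S]; first by exists (\pi g); apply: top_gen_neq0.
case: (pselect (exists2 q : top, q \in S & q != 0)) => [[q Sq q0] | S0]; [right | left].
  have [a qa] := top_gen q.
  have [b [ba _]] : corner_unit e k a.
    by apply: contrapT => /pi_eq0; rewrite -qa => /eqP; apply/negP.
  have Sg : \pi g \in S.
    have -> : \pi g = (e k * b * e k) *: q; last exact: rpredZ.
    by rewrite qa piZ -{2}eg !scalerA ba eg.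
  by move=> x; have [c ->] := top_gen x; rewrite -piZ rpredZ.
by move=> q Sq; apply/eqP/negPn/negP => q0; apply: S0; exists q.
Qed.

(** Sending the class of a g to a e_k x0 is well defined, as the elements of J
    kill M; it is bijective by Schur's lemma. *)
Lemma simple_iso_top (M : lmodType A) :
  simple_module M -> (exists x : M, e k *: x != 0) -> mod_iso M top.
Proof.
move=> Ms [x0 x0_neq0]; apply: mod_iso_sym; pose x := e k *: x0.
have ex : e k *: x = x by rewrite scalerA (frame_idem frameA).
have kill a : ~ corner_unit e k a -> a *: x = 0.
  move=> na; rewrite -ex scalerA.
  apply: (simple_rad frameA (simple_fullsub Ms)); first exact/sub_ofP.
  exact: rad_mule.
have /choice[c gc] : forall p : P, exists a, p = a *: g by [].
pose f (q : top) : M := c (repr q) *: x.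
have fE a : f (\pi (a *: g)) = a *: x.
  apply/eqP; rewrite -subr_eq0 -scalerBl; apply/eqP/kill/mem_rad_cyclic.
  by rewrite scalerBl -gc; apply/piP; rewrite reprK.
have fL : linear f.
  move=> a p q; have [b ->] := top_gen p; have [d ->] := top_gen q.
  have -> : a *: \pi (b *: g) + \pi (d *: g) = \pi ((a * b + d) *: g).
    by rewrite piZ scalerDl -scalerA; apply: pi_quotmD.
  by rewrite !fE scalerDl scalerA.
apply: (bij_linear_iso fL (simple_linear_bij fL top_simple Ms _)).
by exists (\pi g); rewrite -[g]scale1r fE scale1r.
Qed.

Lemma iso_top_simple (M : lmodType A) :
  mod_iso M top -> simple_module M /\ exists x : M, e k *: x != 0.
Proof.
move=> Mt; split; first exact: simple_iso Mt top_simple.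
have [f [h fK hK]] := Mt; exists (h (\pi g)); apply: contraNneq top_gen_neq0 => eh.
by rewrite -top_gen_fix -[\pi g]hK -linearZ eh linear0.
Qed.

End Top.

(** * The Jacobson radical *)

Section Jacobson.
Variables (n : nat) (A : pzRingType) (e : 'I_n -> A).
Hypothesis frameA : basic_frame e.

Lemma maximal_quotient_simple (I : submodule A^o) :
  maximal_left_ideal I -> simple_module (quotm I).
Proof.
move=> [I1 Imax]; pose p (x : A^o) : quotm I := \pi_(quotm I)%qT x.
have piP x y : reflect (p x = p y) (x - y \in I) := quotm_eqP I x y.
have piZ a x : a *: p x = p (a *: x) := quotm_scale_pi I a x.
have piD x y : p x + p y = p (x + y) := pi_quotmD I x y.
have p0 : p 0 = 0 by rewrite -[X in p X](scale0r 0) -piZ scale0r.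
split.
  exists (p 1); apply: contra I1 => /eqP; rewrite -p0 => /piP.
  by rewrite subr0.
move=> S; have KP : @submodule_pred _ A^o (fun x => p x \in S).
  split=> [|a x y Sx Sy]; first by rewrite p0 rpred0.
  by rewrite -piD -piZ rpredD ?rpredZ.
have IK : {subset I <= sub_of KP}.
  move=> x Ix; apply/sub_ofP; suff -> : p x = 0 by apply: rpred0.
  by rewrite -p0; apply/piP; rewrite subr0.
have pE q : q = p (repr q) by rewrite /p reprK.
case: (boolP (1 \in sub_of KP)) => [/sub_ofP S1 | /(Imax _ IK) KI]; [right|left] => q.
  by rewrite [q]pE -[repr q]mulr1; rewrite -[_ * _]/(_ *: (1 : A^o)) -piZ rpredZ.
rewrite [q]pE => Sq; rewrite -p0; apply/piP; rewrite subr0; apply: KI.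
exact/sub_ofP.
Qed.

(** An element of [frame_rad] kills the simple module A / I for every maximal
    left ideal I, so lies in I.  Conversely, for each k the elements a such that
    e_k a e_k is not a unit form a maximal left ideal. *)
Lemma jacobson_frame a : a \in @jacobson A <-> frame_rad e a.
Proof.
split=> [/asboolP Ja k | ra]; last first.
  apply/asboolP => I Imax.
  have := simple_rad frameA (simple_fullsub (maximal_quotient_simple Imax)).
  move/(_ a (\pi_(quotm I)%qT 1)) => /(_ _ ra) H.
  have : a *: \pi_(quotm I)%qT (1 : A^o) = \pi_(quotm I)%qT 0.
    rewrite H; last exact/sub_ofP.
    have <- : 0 *: \pi_(quotm I)%qT (1 : A^o) = 0 by rewrite scale0r.
    by rewrite [LHS](quotm_scale_pi I 0) scale0r.
  rewrite [LHS](quotm_scale_pi I a) => /quotm_eqP.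
  by rewrite subr0 -[_ *: _]/(_ * _) mulr1.
have IP : @submodule_pred _ A^o (fun x => ~ corner_unit e k x).
  split=> [|b x y nx ny]; first exact: corner_unit0.
  apply: corner_unitD => //; rewrite -[_ *: _]/(_ * _) => /(corner_unit_mule frameA).
  by rewrite -mulrA; apply: rad_mull => //; apply: rad_mule.
suff Imax : maximal_left_ideal (sub_of IP) by have /sub_ofP := Ja _ Imax.
split.
  by apply/negP => /sub_ofP; apply; apply: corner_unit1.
move=> K IK K1 x Kx; apply/sub_ofP => -[b [bx _]]; case/negP: K1.
(* Elements of the form y - y e_k lie in the left ideal in question, hence in
   K, so membership in K may be tested after multiplying by e_k. *)
have Kk y : y * e k \in K -> y \in K.
  move=> Ky; rewrite -[y](subrK (y * e k)); apply: rpredD => //.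
  apply/IK/sub_ofP => /(corner_unit_mule frameA).
  rewrite mulrBl -mulrA (frame_idem frameA) subrr; exact: corner_unit0.
have Kmule y : y \in K -> y * e k \in K.
  move=> Ky; rewrite -[y * e k](subrK y); apply: rpredD => //.
  apply/IK/sub_ofP => /(corner_unit_mule frameA).
  rewrite mulrBl -mulrA (frame_idem frameA) subrr; exact: corner_unit0.
apply: Kk; rewrite mul1r -bx.
apply: Kmule; exact: (rpredZ (e k * b * e k : A) Kx).
Qed.
End Jacobson.

(** * The socle of a module, one idempotent at a time *)

Section Corners.
Variables (n : nat) (A : pzRingType) (e : 'I_n -> A).

(** W is a copy, over the ring B, of the submodule of those x in e_k M on which
    only e_k A e_k acts, i.e. e_l A x = 0 for all l <> k.  The map beta plays the
    role of A -> e_k A e_k, a |-> e_k a e_k: it need not be a ring morphism, but on this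
    submodule a acts as e_k a e_k. *)
Record corner_model (k : 'I_n) (M : lmodType A) (B : pzRingType)
    (W : lmodType B) (beta : A -> B) (iota : W -> M) : Prop := CornerModel {
  corner_add : forall u v, iota (u + v) = iota u + iota v;
  corner_inj : injective iota;
  corner_scale : forall a w, iota (beta a *: w) = a *: iota w;
  corner_surj : forall b, exists a, beta a = b;
  corner_fix : forall w, e k *: iota w = iota w;
  corner_image : forall x, e k *: x = x ->
    (forall l a, l != k -> e l *: (a *: x) = 0) -> exists w, iota w = x }.

Section Transfer.
Variables (k : 'I_n) (M : lmodType A) (B : pzRingType) (W : lmodType B).
Variables (beta : A -> B) (iota : W -> M).
Hypothesis cM : corner_model k beta iota.

Lemma corner0 : iota 0 = 0.
Proof. by apply: (addrI (iota 0)); rewrite -(corner_add cM) !addr0. Qed.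

Lemma corner_img_closed (T : submodule W) :
  submodule_pred (fun x => exists2 w, w \in T & iota w = x).
Proof.
split=> [|a _ _ [u Tu <-] [v Tv <-]]; first by exists 0; rewrite ?rpred0 ?corner0.
exists (beta a *: u + v); first by rewrite rpredD ?rpredZ.
by rewrite (corner_add cM) (corner_scale cM).
Qed.

Definition corner_img (T : submodule W) := sub_of (corner_img_closed T).

Lemma mem_corner_img (T : submodule W) w : (iota w \in corner_img T) = (w \in T).
Proof.
apply/idP/idP => [/sub_ofP[v Tv /(corner_inj cM) <-] // | Tw].
by apply/sub_ofP; exists w.
Qed.

Lemma corner_preimg_closed (S : submodule M) :
  submodule_pred (fun w => iota w \in S).
Proof.
split=> [|b u v Su Sv]; first by rewrite corner0 rpred0.
have [a <-] := corner_surj cM b.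
by rewrite (corner_add cM) (corner_scale cM) rpredD ?rpredZ.
Qed.

Definition corner_preimg (S : submodule M) := sub_of (corner_preimg_closed S).

(** As beta is onto, iota identifies the B-submodules of W with the A-submodules
    of M contained in the image of iota. *)
Lemma simple_corner_img (T : submodule W) : simple_sub T <-> simple_sub (corner_img T).
Proof.
split=> -[[x Sx x0] Smin]; split.
- exists (iota x); first by rewrite mem_corner_img.
  by apply: contra x0 => /eqP ix0; apply/eqP/(corner_inj cM); rewrite corner0.
- move=> S ST; case: (Smin (corner_preimg S)) => [w /sub_ofP/ST|S0|TS].
  + by rewrite mem_corner_img.
  + left=> y Sy; have /sub_ofP[w Tw wy] := ST _ Sy.
    by rewrite -wy (S0 w) ?corner0 //; apply/sub_ofP; rewrite wy.
  + by right=> _ /sub_ofP[w /TS/sub_ofP Sw <-].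
- have /sub_ofP[w Tw wx] := Sx; exists w => //.
  by apply: contra x0 => /eqP w0; rewrite -wx w0 corner0.
- move=> S ST; case: (Smin (corner_img S)) => [_ /sub_ofP[w /ST Tw <-]|S0|TS].
  + by rewrite mem_corner_img.
  + left=> w Sw; apply: (corner_inj cM); rewrite corner0; apply: S0.
    by rewrite mem_corner_img.
  + by right=> w Tw; rewrite -mem_corner_img TS // mem_corner_img.
Qed.

Lemma simple_sub_ext (S T : submodule M) : S =i T -> simple_sub S -> simple_sub T.
Proof.
move=> ST [[x Sx x0] Smin]; split; first by exists x; rewrite -?ST.
move=> U UT; case: (Smin U) => [x' /UT|U0|SU]; first by rewrite ST.
  by left.
by right=> y; rewrite -ST => /SU.
Qed.

Lemma soc_corner_img w : w \in soc W -> iota w \in soc M.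
Proof.
suff sW : {subset soc W <= corner_preimg (soc M)} by move=> /sW/sub_ofP.
apply: soc_sub => T Ts v Tv; apply/sub_ofP.
by apply: (@mem_soc _ _ (corner_img T)); rewrite ?mem_corner_img //; apply/simple_corner_img.
Qed.

Hypothesis frameA : basic_frame e.

(** A simple submodule S of M is killed by e_k, or it is concentrated at k by
    [simple_component]; in the latter case it is contained in the image of
    iota. *)
Lemma soc_component x : x \in soc M -> exists2 w, w \in soc W & iota w = e k *: x.
Proof.
(* The quantification over a makes this condition stable under scaling. *)
have QP : submodule_pred (fun x => forall a, e k *: (a *: x) \in corner_img (soc W)).
  split=> [a|b y z Qy Qz a]; first by rewrite !scaler0 rpred0.
  by rewrite scalerDr scalerA scalerDr rpredD.
suff sQ : {subset soc M <= sub_of QP}.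
  by move=> /sQ/sub_ofP/(_ 1); rewrite scale1r => /sub_ofP.
apply: soc_sub => S Ss y Sy; apply/sub_ofP => a.
have [-> | y0] := eqVneq (e k *: (a *: y)) 0; first exact: rpred0.
have S_k l z : z \in S -> l != k -> e l *: z = 0.
  by move=> Sz; apply: (simple_component frameA Ss (rpredZ a Sy) Sz y0).
have S_img z : z \in S -> exists w, iota w = z.
  move=> Sz; apply: (corner_image cM) => [|l b lk].
    by rewrite -(frame_comp frameA) // => l; apply: S_k.
  by apply: S_k => //; apply: rpredZ.
have Seay : e k *: (a *: y) \in S by rewrite !rpredZ.
have [w wy] := S_img _ Seay; rewrite -wy mem_corner_img.
apply: (@mem_soc _ _ (corner_preimg S)); last by apply/sub_ofP; rewrite wy.
apply/simple_corner_img; apply: simple_sub_ext Ss => z.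
apply/idP/sub_ofP => [Sz | [v /sub_ofP Sv <-] //].
by have [v vz] := S_img z Sz; exists v => //; apply/sub_ofP; rewrite vz.
Qed.

Lemma soc_concentrated :
  (forall l x, l != k -> x \in soc M -> e l *: x = 0) ->
  simple_sub (soc M) <-> simple_sub (soc W).
Proof.
move=> M_k; rewrite simple_corner_img.
suff E : soc M =i corner_img (soc W).
  by split; apply: simple_sub_ext => x; rewrite E.
move=> x; apply/idP/sub_ofP => [sx | [w sw <-]]; last exact: soc_corner_img.
have [w sw wx] := soc_component sx; exists w => //.
by rewrite wx -(frame_comp frameA) // => l lk; apply: M_k.
Qed.

End Transfer.

(** By the two lemmas on tops, the left-hand side says that soc M is simple and
    not killed by e_k; it is then concentrated at k, so that it coincides with
    the socle of W k by [soc_concentrated]. *)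
Lemma soc_iso_top (M P : lmodType A) (k : 'I_n) (g : P) (J : {pred A})
    (B : 'I_n -> pzRingType) (W : forall l, lmodType (B l))
    (beta : forall l, A -> B l) (iota : forall l, W l -> M) :
  basic_frame e -> (forall l, corner_model l (beta l) (@iota l)) ->
  e k *: g = g -> (forall x, exists a, x = a *: g) ->
  (forall a, a *: g = 0 -> a * e k = 0) ->
  (forall a, a \in J <-> frame_rad e a) ->
  mod_iso (subm (soc M)) (quotm (smul J P)) <->
  (forall l, l != k -> forall w, w \in soc (W l) -> w = 0) /\
  simple_module (subm (soc (W k))).
Proof.
move=> frameA cM eg genP annP radJ.
pose M_k := forall l x, l != k -> x \in soc M -> e l *: x = 0.
split=> [Mt | [W0 Wk]].
  have [/simple_subE Ms [[x sx] x0]] := iso_top_simple frameA eg genP annP radJ Mt.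
  have {}x0 : e k *: x != 0.
    by apply: contra x0 => /eqP x0; apply/eqP/val_inj; rewrite GRing.valZ.
  have socM_k : M_k.
    by move=> l y lk sy; apply: (simple_component frameA Ms sx sy x0 lk).
  split=> [l lk w sw|]; last by apply/simple_subE/(soc_concentrated (cM k) frameA).
  apply: (corner_inj (cM l)); rewrite (corner0 (cM l)) -(corner_fix (cM l)).
  exact: socM_k lk (soc_corner_img (cM l) sw).
have socM_k : M_k.
  move=> l x lk /(soc_component (cM l) frameA)[w sw <-].
  by rewrite (W0 l lk w sw) (corner0 (cM l)).
have /(soc_concentrated (cM k) frameA socM_k) Ms : simple_sub (soc (W k)).
  exact/simple_subE.
apply: (simple_iso_top frameA eg genP annP radJ); first exact/simple_subE.
have [[x sx x0] _] := Ms; exists (Subm sx); apply: contra x0 => /eqP/(congr1 val).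
rewrite GRing.valZ /= => ex0; rewrite (@frame_comp _ _ _ frameA _ k x) ?ex0 // => l lk.
exact: socM_k.
Qed.

End Corners.

(** * Matrix units and canonical idempotents *)

Section FormalMatrixRing.
Variables (n : nat) (D : fm_data n).
Implicit Types (i j k l : 'I_n) (X Y : fmx D).

Lemma fmx_mulE X Y i j :
  entry (X * Y) i j = \sum_k prodh (entry X i k) (entry Y k j).
Proof. exact: fmx_ofE. Qed.

Lemma entry0 i j : entry (0 : fmx D) i j = 0.
Proof. exact: fmx_ofE. Qed.

Lemma cidem_mull i X k l :
  entry (cidem D i * X) k l = if k == i then entry X k l else 0.
Proof.
rewrite fmx_mulE; case: eqP => [-> | /eqP ki].
  rewrite (bigD1 i) //= fmx_ofE eqxx id_entry_id prod1h big1 ?addr0 // => m mi.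
  by rewrite fmx_ofE eqxx id_entry_neq 1?eq_sym // prod0h.
by rewrite big1 // => m _; rewrite fmx_ofE (negPf ki) prod0h.
Qed.

Lemma cidem_mulr j X k l :
  entry (X * cidem D j) k l = if l == j then entry X k l else 0.
Proof.
rewrite fmx_mulE; case: eqP => [-> | /eqP lj].
  rewrite (bigD1 j) //= fmx_ofE eqxx id_entry_id prodh1 big1 ?addr0 // => m mj.
  by rewrite fmx_ofE (negPf mj) prodh0.
rewrite big1 // => m _; rewrite fmx_ofE; case: eqP => [-> | _]; last exact: prodh0.
by rewrite id_entry_neq 1?eq_sym // prodh0.
Qed.

Lemma cidem_mulm X j Y i k :
  entry (X * cidem D j * Y) i k = prodh (entry X i j) (entry Y j k).
Proof.
rewrite fmx_mulE (bigD1 j) //= cidem_mulr eqxx big1 ?addr0 // => l lj.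
by rewrite cidem_mulr (negPf lj) prod0h.
Qed.

Definition delta i j (m : bimod D i j) : fmx D :=
  [ffun p : 'I_n * 'I_n =>
     @dfwith _ (fun p => bimod D p.1 p.2) (fun=> 0) (i, j) m p].

Lemma delta_id i j m : entry (@delta i j m) i j = m.
Proof. by rewrite /entry ffunE dfwith_in. Qed.

Lemma delta_neq i j m k l : (k, l) != (i, j) -> entry (@delta i j m) k l = 0.
Proof. by move=> kl; rewrite /entry ffunE dfwith_out // eq_sym. Qed.

Lemma deltaP i j (X : fmx D) :
  (forall k l, (k, l) != (i, j) -> entry X k l = 0) -> delta (entry X i j) = X.
Proof.
move=> X0; apply: fmxP => k l; case: (eqVneq (k, l) (i, j)) => [[-> ->] | kl].
  exact: delta_id.
by rewrite delta_neq ?X0.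
Qed.

Lemma deltaD i j (m m' : bimod D i j) : delta (m + m') = delta m + delta m'.
Proof.
apply: fmxP => k l; rewrite fmx_addE.
case: (eqVneq (k, l) (i, j)) => [[-> ->] | kl]; first by rewrite !delta_id.
by rewrite !delta_neq ?addr0.
Qed.

Lemma cidem_delta i j m : cidem D i * @delta i j m = delta m.
Proof.
apply: fmxP => k l; rewrite cidem_mull; case: eqP => // /eqP ki.
by rewrite delta_neq // xpair_eqE negb_and ki.
Qed.

Lemma delta_cidem i j m : @delta i j m * cidem D j = delta m.
Proof.
apply: fmxP => k l; rewrite cidem_mulr; case: eqP => // /eqP lj.
by rewrite delta_neq // xpair_eqE negb_and lj orbT.
Qed.

Lemma cidem_corner i X j : cidem D i * X * cidem D j = delta (entry X i j).
Proof.
apply: fmxP => k l; rewrite cidem_mulr cidem_mull.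
by case: (eqVneq l j) => [->|lj]; case: (eqVneq k i) => [->|ki];
  rewrite ?delta_id // delta_neq // xpair_eqE negb_and ?ki ?lj ?orbT.
Qed.

Lemma delta_mul i j k (m : bimod D i j) (m' : bimod D j k) :
  delta m * delta m' = delta (prodh m m').
Proof.
rewrite -(cidem_delta m) -{1}(delta_cidem m) -(delta_cidem m') !mulrA.
by rewrite -(mulrA (cidem D i)) -(mulrA (cidem D i)) cidem_corner cidem_mulm !delta_id.
Qed.

Lemma delta1 i : delta (diag1 D i) = cidem D i.
Proof.
rewrite -id_entry_id; have <- : entry (cidem D i) i i = id_entry D i i.
  by rewrite fmx_ofE eqxx.
apply: deltaP => k l; rewrite xpair_eqE negb_and fmx_ofE.
case: (eqVneq k i) => //= -> li.
by rewrite id_entry_neq // eq_sym.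
Qed.

Lemma delta_inj i j : injective (@delta i j).
Proof. by move=> m m' /(congr1 (fun X => entry X i j)); rewrite !delta_id. Qed.

Lemma cidem_corner_unit i X :
  corner_unit (cidem D) i X <-> @invertible (diag D i) (entry X i i).
Proof.
have mulE Y Z : cidem D i * Y * cidem D i * Z * cidem D i =
    delta (prodh (entry Y i i) (entry Z i i)).
  by rewrite -!mulrA !mulrA -(mulrA (cidem D i)) -(mulrA (cidem D i)) cidem_corner cidem_mulm.
split=> [[b [l r]] | [b [r l]]].
  by exists (entry b i i); split; apply: delta_inj; rewrite -mulE ?l ?r ?delta1.
by exists (delta b); split; rewrite mulE delta_id -delta1; congr delta.
Qed.

Lemma cidemK i : cidem D i * cidem D i = cidem D i.
Proof. by rewrite -delta1 delta_mul prod1h. Qed.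

Lemma rprin_mem i X : cidem D i * X \in Submodule (@rprin_pred_closed _ (cidem D i)).
Proof. by apply/asboolP; exists X. Qed.

Lemma rprin_fix i (x : rprin (cidem D i)) : cidem D i * (val x : fmx D) = val x.
Proof. by case: x => x /= /asboolP[a ->]; rewrite mulrA cidemK. Qed.

Lemma lprin_mem i X : X * cidem D i \in Submodule (@lprin_pred_closed _ (cidem D i)).
Proof. by apply/asboolP; exists X. Qed.

Lemma lprin_fix i (x : lprin (cidem D i)) : (val x : fmx D) * cidem D i = val x.
Proof. by case: x => x /= /asboolP[a ->]; rewrite -mulrA cidemK. Qed.

(** For basicness, mutually inverse elements a of e_j R e_i and b of e_i R e_j
    give by left multiplication an isomorphism between e_i R and e_j R. *)
Lemma fmx_frame : (forall i, local_ring (diag D i)) -> basic D ->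
  basic_frame (cidem D).
Proof.
move=> Dlocal Dbasic; split.
- exact: cidemK.
- move=> i j ij; apply: fmxP => k l; rewrite cidem_mull entry0.
  by case: eqP => // ->; rewrite fmx_ofE (negPf ij).
- apply: fmxP => k l.
  have -> : entry (\sum_i cidem D i) k l = \sum_i entry (cidem D i) k l.
    by apply: (big_morph (fun X : fmx D => entry X k l)) => [X Y|]; rewrite ?fmx_addE ?entry0.
  rewrite (bigD1 k) //= big1 ?addr0 => [|i ik]; rewrite !fmx_ofE ?eqxx //.
  by rewrite eq_sym (negPf ik).
- move=> i; have [d0 _] := Dlocal i; apply: contra d0 => /eqP ei.
  by rewrite -[X in X == _]/(diag1 D i) -(delta_id (diag1 D i)) delta1 ei entry0.
- move=> i X Y /cidem_corner_unit XY.
  by have [_ /(_ (entry X i i) (entry Y i i))[]] := Dlocal i;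
    rewrite -?fmx_addE //; [left|right]; apply/cidem_corner_unit.
- move=> i j a b ij ba ab; apply: (Dbasic i j ij).
  pose f (x : rprin (cidem D i)) : rprin (cidem D j) :=
    Subm (rprin_mem j (a * (val x : fmx D))).
  pose h (x : rprin (cidem D j)) : rprin (cidem D i) :=
    Subm (rprin_mem i (b * (val x : fmx D))).
  apply: (@bij_linear_iso _ _ _ f) => [c x y|].
    apply: val_inj => /=.
    by rewrite -[c *: _]/((val x : fmx D) * c) !mulrDr !mulrA.
  exists h => x; apply: val_inj => /=; rewrite -(rprin_fix x) !mulrA.
    by rewrite ba.
  by rewrite ab.
Qed.

End FormalMatrixRing.

(** * Socles of rows and columns *)

Section Coordinates.
Variables (n : nat) (D : fm_data n).
Implicit Types i j k l : 'I_n.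

Lemma annRP i j m : reflect (forall k, k != j -> forall b : bimod D j k, prodh m b = 0)
  (m \in annR D i j).
Proof. exact: asboolP. Qed.

Lemma annLP i j m : reflect (forall h, h != i -> forall b : bimod D h i, prodh b m = 0)
  (m \in annL D i j).
Proof. exact: asboolP. Qed.

Definition iotaR i j (w : subm (annR D i j)) : rprin (cidem D i) :=
  Subm (rprin_mem i (delta (val w : bimod D i j))).

Definition iotaL i j (w : subm (annL D i j)) : lprin (cidem D j) :=
  Subm (lprin_mem j (delta (val w : bimod D i j))).

Lemma corner_modelR i j :
  @corner_model n (fmx D)^c (cidem D) j (rprin (cidem D i)) (diag D j)^c
    (subm (annR D i j)) (fun X : fmx D => entry X j j) (@iotaR i j).
Proof.
split=> [u v|u v|a w|b|w|x xe x0].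
- by apply: val_inj => /=; rewrite deltaD mulrDr.
- by move/(congr1 val) => /=; rewrite !cidem_delta => /delta_inj uv; apply: val_inj.
- apply: val_inj; rewrite [RHS]GRing.valZ /= -[RHS]/((cidem D i * delta _) * (a : fmx D)).
  rewrite !cidem_delta -[in RHS]delta_cidem; apply: fmxP => k l.
  rewrite cidem_mulm.
  have [-> | ki] := eqVneq k i; last first.
    by rewrite !delta_neq ?prod0h // xpair_eqE negb_and ki.
  rewrite delta_id; have [-> | lj] := eqVneq l j; first by rewrite delta_id.
  rewrite delta_neq ?xpair_eqE ?negb_and ?lj ?orbT //.
  by have /annRP -> := valP w.
- by exists (delta b); rewrite delta_id.
- apply: val_inj; rewrite GRing.valZ /= -[LHS]/((cidem D i * delta _) * cidem D j).
  by rewrite cidem_delta delta_cidem.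
have {}xe : (val x : fmx D) * cidem D j = val x by rewrite -[in RHS]xe GRing.valZ.
have xE : delta (entry (val x) i j) = val x.
  by rewrite -cidem_corner rprin_fix.
have xann : (entry (val x) i j : bimodR D i j) \in annR D i j.
  apply/annRP => k kj b.
  have /(congr1 val) := x0 k (delta b) kj; rewrite !GRing.valZ GRing.val0.
  rewrite -[LHS]/((val x : fmx D) * delta b * cidem D k) -mulrA delta_cidem -xE delta_mul.
  by move/(congr1 (fun X : fmx D => entry X i k)); rewrite !delta_id entry0.
by exists (Subm xann); apply: val_inj; rewrite /= cidem_delta.
Qed.

Lemma corner_modelL i j :
  @corner_model n (fmx D) (cidem D) i (lprin (cidem D j)) (diag D i)
    (subm (annL D i j)) (fun X : fmx D => entry X i i) (@iotaL i j).
Proof.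
split=> [u v|u v|a w|b|w|x xe x0].
- by apply: val_inj => /=; rewrite deltaD mulrDl.
- by move/(congr1 val) => /=; rewrite !delta_cidem => /delta_inj uv; apply: val_inj.
- apply: val_inj; rewrite [RHS]GRing.valZ /= -[RHS]/((a : fmx D) * (delta _ * cidem D j)).
  rewrite !delta_cidem -[in RHS]cidem_delta mulrA; apply: fmxP => k l.
  rewrite cidem_mulm.
  have [-> | lj] := eqVneq l j; last first.
    by rewrite !delta_neq ?prodh0 // xpair_eqE negb_and lj orbT.
  rewrite delta_id; have [-> | ki] := eqVneq k i; first by rewrite delta_id.
  rewrite delta_neq ?xpair_eqE ?negb_and ?ki //.
  by have /annLP -> := valP w.
- by exists (delta b); rewrite delta_id.
- apply: val_inj; rewrite GRing.valZ /= -[LHS]/(cidem D i * (delta _ * cidem D j)).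
  by rewrite delta_cidem cidem_delta.
have {}xe : cidem D i * (val x : fmx D) = val x by rewrite -[in RHS]xe GRing.valZ.
have xE : delta (entry (val x) i j) = val x.
  by rewrite -cidem_corner -mulrA lprin_fix.
have xann : (entry (val x) i j : bimodL D i j) \in annL D i j.
  apply/annLP => h hi b.
  have /(congr1 val) := x0 h (delta b) hi; rewrite !GRing.valZ GRing.val0.
  rewrite -[LHS]/(cidem D h * (delta b * (val x : fmx D))) -xE delta_mul cidem_delta.
  by move/(congr1 (fun X : fmx D => entry X h j)); rewrite !delta_id entry0.
by exists (Subm xann); apply: val_inj; rewrite /= delta_cidem.
Qed.

Hypothesis frameD : basic_frame (cidem D).

(** The right module e_i R is a left module over the converse ring, whose frame
    has the same radical by [frame_rad_converse]. *)
Lemma socR_iso_top i j :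
  mod_iso (subm (soc (rprin (cidem D i)))) (topR (rprin (cidem D j))) <->
  (forall l, l != j ->
     forall w, w \in soc (subm (annR D i l)) -> w = 0) /\
  simple_module (subm (soc (subm (annR D i j)))).
Proof.
apply: (@soc_iso_top n (fmx D)^c (cidem D) _ (rprin (cidem D j)) j
  (Subm (rprin_mem j 1)) _ _ _ _ (@iotaR i)).
- exact: basic_frame_converse.
- exact: corner_modelR.
- apply: val_inj; rewrite GRing.valZ /= -[LHS]/(cidem D j * 1 * cidem D j).
  by rewrite !mulr1 cidemK.
- move=> x; exists (val x); apply: val_inj; rewrite GRing.valZ /=.
  by rewrite -[RHS]/(cidem D j * 1 * (val x : fmx D)) mulr1 rprin_fix.
- move=> a /(congr1 val); rewrite GRing.valZ /=.
  by rewrite -[_ *: _]/(cidem D j * 1 * (a : fmx D)) mulr1.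
move=> a; rewrite frame_rad_converse; exact: jacobson_frame.
Qed.

Lemma socL_iso_top i j :
  mod_iso (subm (soc (lprin (cidem D j)))) (topL (lprin (cidem D i))) <->
  (forall l, l != i ->
     forall w, w \in soc (subm (annL D l j)) -> w = 0) /\
  simple_module (subm (soc (subm (annL D i j)))).
Proof.
apply: (@soc_iso_top n (fmx D) (cidem D) _ (lprin (cidem D i)) i
  (Subm (lprin_mem i 1)) _ _ _ _ (fun l => @iotaL l j)).
- exact: frameD.
- by move=> l; apply: corner_modelL.
- apply: val_inj; rewrite GRing.valZ /= -[LHS]/(cidem D i * (1 * cidem D i)).
  by rewrite !mul1r cidemK.
- move=> x; exists (val x); apply: val_inj; rewrite GRing.valZ /=.
  by rewrite -[RHS]/((val x : fmx D) * (1 * cidem D i)) mul1r lprin_fix.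
- move=> a /(congr1 val); rewrite GRing.valZ /=.
  by rewrite -[_ *: _]/((a : fmx D) * (1 * cidem D i)) mul1r.
exact: jacobson_frame.
Qed.

Lemma annR_soc0 i j :
  (forall m : bimod D i j, m <> 0 ->
     exists k, k != j /\ exists b : bimod D j k, prodh m b <> 0) ->
  forall x, x \in soc (subm (annR D i j)) -> x = 0.
Proof.
move=> m_k x _; apply: val_inj; apply: contrapT => x0; have [k [kj [b]]] := m_k _ x0; apply.
by have /annRP -> := valP x.
Qed.

Lemma annL_soc0 i j :
  (forall m : bimod D i j, m <> 0 ->
     exists h, h != i /\ exists b : bimod D h i, prodh b m <> 0) ->
  forall x, x \in soc (subm (annL D i j)) -> x = 0.
Proof.
move=> m_h x _; apply: val_inj; apply: contrapT => x0; have [h [hi [b]]] := m_h _ x0; apply.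
by have /annLP -> := valP x.
Qed.

End Coordinates.

Theorem theorem9 (n : nat) (D : fm_data n)
    (Dlocal : forall i : 'I_n, local_ring (diag D i))
    (Dbasic : basic D) (s : 'S_n) :
  nakayama_perm D s <->
  forall i : 'I_n,
    [/\
      (forall j : 'I_n, j != s i ->
         (forall m : bimod D i j, m <> 0 ->
            exists k : 'I_n,
              k != j /\ exists b : bimod D j k, prodh m b <> 0)
         \/
         (forall x : subm (annR D i j), x \in soc (subm (annR D i j)) -> x = 0)),
      (forall j : 'I_n, j != s i ->
         (forall m : bimod D i j, m <> 0 ->
            exists h : 'I_n,
              h != i /\ exists b : bimod D h i, prodh b m <> 0)
         \/
         (forall x : subm (annL D i j), x \in soc (subm (annL D i j)) -> x = 0)),
      simple_module (subm (soc (subm (annR D i (s i)))))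
    & simple_module (subm (soc (subm (annL D i (s i)))))].
Proof.
have frameD := fmx_frame Dlocal Dbasic; split=> [Nak i | cond i].
  have [/(socR_iso_top frameD)[R0 Rs] /(socL_iso_top frameD)[_ Ls]] := Nak i.
  split=> // j ji; right; first exact: R0.
  (* The pair (i, j) belongs to the column of index j = s (s^-1 j). *)
  have [_ /(socL_iso_top frameD)[L0 _]] := Nak (s^-1%g j).
  rewrite permKV in L0; apply: L0; apply: contra ji => /eqP ->.
  by rewrite permKV.
have [R0 _ Rs Ls] := cond i; split; [apply/(socR_iso_top frameD)|apply/(socL_iso_top frameD)].
  by split=> // l li; have [/annR_soc0|] := R0 l li.
split=> // l li; have [_ L0 _ _] := cond l.
have [||] := L0 (s i) => //; last exact: annL_soc0.
by rewrite (inj_eq perm_inj) eq_sym.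
Qed.
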